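(* Let $E$ be a finite-dimensional vector space over a field and let $\mathrm{cl}:\mathcal{L}(E)\to\mathcal{L}(E)$ satisfy the closure axioms (Cl1)–(Cl4). Let $\mathcal{I}_{\mathrm{cl}}$ be the set of subspaces $I$ of $E$ such that $\mathrm{cl}(A)\neq\mathrm{cl}(I)$ for every subspace $A\subseteq I$ of codimension $1$ in $I$. Then $\mathcal{I}_{\mathrm{cl}}$ satisfies the independence axioms (I1)–(I4).
   Context: $\mathcal{L}(E)$ is the lattice of subspaces of $E$. Closure axioms: (Cl1) $A\subseteq\mathrm{cl}(A)$ for all $A$; (Cl2) $A\subseteq B\Rightarrow \mathrm{cl}(A)\subseteq\mathrm{cl}(B)$; (Cl3) $\mathrm{cl}(\mathrm{cl}(A))=\mathrm{cl}(A)$; (Cl4) for all subspaces $A$ and $1$-dimensional subspaces $x,y$, if $y\subseteq\mathrm{cl}(A+x)$ and $y\not\subseteq\mathrm{cl}(A)$ then $x\subseteq\mathrm{cl}(A+y)$. For $X\in\mathcal{L}(E)$ and a collection $\mathcal{A}$, $\max(\mathcal{A}\cap\mathcal{L}(X))$ denotes the inclusion-maximal members of $\mathcal{A}$ contained in $X$. Independence axioms for $\mathcal{I}\subseteq\mathcal{L}(E)$: (I1) $\mathcal{I}\neq\emptyset$; (I2) if $J\in\mathcal{I}$ and $I\subseteq J$ then $I\in\mathcal{I}$; (I3) for $I,J\in\mathcal{I}$ with $\dim I<\dim J$ there is a $1$-dimensional $x\subseteq J$, $x\not\subseteq I$, with $I+x\in\mathcal{I}$; (I4) for all subspaces $A,B$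 and $I\in\max(\mathcal{I}\cap\mathcal{L}(A))$, $J\in\max(\mathcal{I}\cap\mathcal{L}(B))$ there is $K\in\max(\mathcal{I}\cap\mathcal{L}(A+B))$ with $K\subseteq I+J$. *)

(* Defs.v *)
From HB Require Import structures.
From mathcomp Require Import all_boot all_order all_algebra.

Set Implicit Arguments.
Unset Strict Implicit.
Unset Printing Implicit Defensive.

Import GRing.Theory.
Local Open Scope ring_scope.

Section QMatroidAxioms.

Variables (F : fieldType) (E : vectType F).

(* Over an infinite field there are infinitely many subspaces, so a collection
   of subspaces is a Prop-valued predicate on {vspace E}. *)
Definition collection := {vspace E} -> Prop.

Record closure_axioms (cl : {vspace E} -> {vspace E}) : Prop := ClosureAxioms {
  Cl1 : forall A : {vspace E}, (A <= cl A)%VS;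
  Cl2 : forall A B : {vspace E}, (A <= B)%VS -> (cl A <= cl B)%VS;
  Cl3 : forall A : {vspace E}, cl (cl A) = cl A;
  Cl4 : forall A x y : {vspace E}, \dim x = 1%N -> \dim y = 1%N ->
    (y <= cl (A + x))%VS -> ~~ (y <= cl A)%VS -> (x <= cl (A + y))%VS
}.

Definition max_in (C : collection) (X I : {vspace E}) : Prop :=
  [/\ C I, (I <= X)%VS &
    forall J : {vspace E}, C J -> (J <= X)%VS -> (I <= J)%VS -> J = I].

Record independence_axioms (C : collection) : Prop := IndependenceAxioms {
  I1 : exists I : {vspace E}, C I;
  I2 : forall I J : {vspace E}, C J -> (I <= J)%VS -> C I;
  I3 : forall I J : {vspace E}, C I -> C J -> (\dim I < \dim J)%N ->
    exists x : {vspace E},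
      [/\ \dim x = 1%N, (x <= J)%VS, ~~ (x <= I)%VS & C (I + x)%VS];
  I4 : forall A B I J : {vspace E}, max_in C A I -> max_in C B J ->
    exists2 K : {vspace E}, max_in C (A + B)%VS K & (K <= I + J)%VS
}.

(* The hyperplanes of I are the A <= I with \dim I = (\dim A).+1; for I = 0
   there are none, so the zero space is always independent. *)
Definition indep_of_closure (cl : {vspace E} -> {vspace E}) : collection :=
  fun I => forall A : {vspace E},
    (A <= I)%VS -> \dim I = (\dim A).+1 -> cl A <> cl I.

End QMatroidAxioms.

(* Main.v *)
Require Import Defs.
From mathcomp Require Import all_boot all_order all_algebra.
From mathcomp Require Import zify.

(** If [I] is independent and [v] lies outside [cl I], then [I + <[v]>] is
    independent. Combined with a Steinitz exchange, this shows that an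
    independent subspace of [cl A] has dimension at most [\dim A]. Hence an
    independent subspace of [A] whose closure contains [A] is maximal in [A], and
    conversely; every maximality statement reduces to an inclusion of closures. *)

Set Implicit Arguments.
Unset Strict Implicit.
Unset Printing Implicit Defensive.

Section Hyperplanes.

Variables (F : fieldType) (E : vectType F).
Implicit Types (U H J : {vspace E}) (v w : E).

Lemma dim_addv_line U v : v \notin U -> \dim (U + <[v]>)%VS = (\dim U).+1.
Proof.
move=> vU; have v0 : v != 0%R by apply: contraNneq vU => ->; rewrite mem0v.
rewrite dimv_disjoint_sum ?dim_vline ?v0 ?addn1 //; apply/eqP; rewrite -subv0.
apply/subvP => u; rewrite memv_cap => /andP[uU /vlineP[k uE]].
have [k0|k0] := eqVneq k 0%R; first by rewrite uE k0 GRing.scale0r mem0v.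
by case/negP: vU; rewrite -(GRing.scalerK k0 v) -uE memvZ.
Qed.

Lemma hyperplane_addv_line H J v : (H <= J)%VS -> \dim J = (\dim H).+1 ->
  v \in J -> v \notin H -> (H + <[v]>)%VS = J.
Proof.
move=> HJ dJ vJ vH; apply/eqP.
by rewrite eqEdim subv_add HJ -memvE vJ dim_addv_line // dJ leqnn.
Qed.

(** Take [H] to be [U] plus a complement [D] in [J] of [U + <[w]>]; a dimension count keeps [w] out
    of it. *)
Lemma ex_hyperplane U J w : (U <= J)%VS -> w \in J -> w \notin U ->
  exists H, [/\ (U <= H)%VS, (H <= J)%VS, \dim J = (\dim H).+1 & w \notin H].
Proof.
move=> UJ wJ wU; pose W := (U + <[w]>)%VS; pose D := (J :\: W)%VS.
have WJ : (W <= J)%VS by rewrite subv_add UJ -memvE.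
have DW : (D + W)%VS = J by rewrite addv_diff; apply/addv_idPl.
have dJ : \dim J = (\dim D + (\dim U).+1)%N.
  by rewrite -DW dimv_disjoint_sum ?capv_diff // dim_addv_line.
have HwJ : ((D + U) + <[w]>)%VS = J by rewrite -addvA.
have wH : w \notin (D + U)%VS.
  apply/negP; rewrite memvE => /addv_idPl wH; rewrite wH in HwJ.
  have := dimv_sum_cap D U; rewrite HwJ; lia.
exists (D + U)%VS; split=> //; first exact: addvSr.
  by rewrite -HwJ addvSl.
by rewrite -(dim_addv_line wH) HwJ.
Qed.

End Hyperplanes.

Section IndependenceOfClosure.

Variables (F : fieldType) (E : vectType F).
Variable cl : {vspace E} -> {vspace E}.
Hypothesis hcl : closure_axioms cl.
Implicit Types (A B I J K U : {vspace E}) (u v : E).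

Local Notation indep := (indep_of_closure cl).

Lemma closure_le A B : (A <= cl B)%VS -> (cl A <= cl B)%VS.
Proof. by move=> AB; rewrite -(Cl3 hcl B) (Cl2 hcl). Qed.

Lemma closure_eq A B : (A <= B)%VS -> (B <= cl A)%VS -> cl A = cl B.
Proof. by move=> AB BA; apply: subv_anti; rewrite (Cl2 hcl) // closure_le. Qed.

Lemma closure_exchange A u v : v \in cl (A + <[u]>)%VS -> v \notin cl A ->
  u \in cl (A + <[v]>)%VS.
Proof.
move=> vAu vA; have [->|u0] := eqVneq u 0%R; first exact: mem0v.
have v0 : v != 0%R by apply: contraNneq vA => ->; rewrite mem0v.
by rewrite memvE (Cl4 hcl) ?dim_vline ?u0 ?v0 // -memvE.
Qed.

Lemma indep0 : indep 0%VS.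
Proof. by move=> A _; rewrite dimv0. Qed.

(** A hyperplane [A] of [I] with the closure of [I] lifts to [J]: adding a complement [C] of [I] in
    [J] gives a hyperplane [C + A] of [J] with the closure of [J]. *)
Lemma indep_sub I J : indep J -> (I <= J)%VS -> indep I.
Proof.
move=> iJ IJ A AI dI clA; pose C := (J :\: I)%VS.
have CI : (C + I)%VS = J by rewrite addv_diff; apply/addv_idPl.
have CI0 : (C :&: I)%VS = 0%VS by rewrite capv_diff.
have CA0 : (C :&: A)%VS = 0%VS.
  by apply/eqP; rewrite -subv0 -CI0 capvS.
have CAJ : (C + A <= J)%VS by rewrite -CI addvS.
apply: (iJ (C + A)%VS) => //.
  by rewrite -{1}CI !dimv_disjoint_sum // dI addnS.
apply: closure_eq => //; rewrite -{1}CI subv_add.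
rewrite (subv_trans (addvSl C A) (Cl1 hcl _)) /=.
by rewrite (subv_trans (Cl1 hcl I)) // -clA (Cl2 hcl) // addvSr.
Qed.

(** A hyperplane [A] of [I + <[v]>] with the same closure cannot be [I], so [A] and [I] share a
    common hyperplane [B]. Exchange over [B] puts [A] inside [cl I], hence [v] too, a
    contradiction. *)
Lemma indep_adjoin I v : indep I -> v \notin cl I -> indep (I + <[v]>)%VS.
Proof.
move=> iI vI A AIv; have vI' : v \notin I.
  by apply: contra vI; apply: subvP (Cl1 hcl I) v.
rewrite dim_addv_line // => -[dA] clA.
have vclA : v \in cl A.
  by rewrite clA memvE (subv_trans (addvSr I _) (Cl1 hcl _)).
have [IA|/subvPn[z zI zA]] := boolP (I <= A)%VS.
  suff AI : A = I by rewrite AI (negPf vI) in vclA.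
  by apply/eqP; rewrite eq_sym eqEdim IA dA leqnn.
have zAI : (A + <[z]>)%VS = (I + <[v]>)%VS.
  apply: hyperplane_addv_line; rewrite ?dim_addv_line ?dA //.
  by apply: subvP zI; apply: addvSl.
have sAI : (A + I)%VS = (I + <[v]>)%VS.
  by apply: subv_anti; rewrite subv_add AIv addvSl -zAI addvS // -memvE.
pose B := (A :&: I)%VS.
have dB : \dim I = (\dim B).+1.
  have := dimv_sum_cap A I; rewrite sAI dim_addv_line // -/B; lia.
have zB : z \notin B by rewrite memv_cap (negPf zA).
have BzI : (B + <[z]>)%VS = I by apply: hyperplane_addv_line; rewrite ?capvSr.
(* Otherwise the hyperplane [B] of [I] would have the closure of [I]. *)
have zclB : z \notin cl B.
  apply/negP => zclB; apply: (iI B) => //; first exact: capvSr.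
  by apply: closure_eq; rewrite ?capvSr // -BzI subv_add (Cl1 hcl) -memvE.
have /subvPn[y yA yB] : ~~ (A <= B)%VS.
  by apply/negP => /dimvS; rewrite -dA dB ltnn.
have ByA : (B + <[y]>)%VS = A.
  by apply: hyperplane_addv_line; rewrite ?capvSl // -dA.
(* Here [z] lies in [cl (B + <[y]>)], which is [cl A], but not in [cl B], so [y] and [z] trade
   places. *)
have ycl : y \in cl I.
  rewrite -BzI; apply: closure_exchange => //; rewrite ByA clA.
  by apply: (subvP (Cl1 hcl _)); apply: subvP zI; apply: addvSl.
case/negP: vI; apply: subvP vclA; apply: closure_le.
by rewrite -ByA subv_add -memvE ycl (subv_trans (capvSr A I) (Cl1 hcl _)).
Qed.

(* Steinitz: while [J] is not inside [A], swap a vector of [J] outside [A] for a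
   vector of [A], which enlarges [A :&: J]. *)
Lemma indep_dim_le A J : indep J -> (J <= cl A)%VS -> \dim J <= \dim A.
Proof.
have [n] := ubnP (\dim A - \dim (A :&: J)); elim: n J => // n IHn J ltn iJ JclA.
have [/dimvS //|/subvPn[w wJ wA]] := boolP (J <= A)%VS.
have wAJ : w \notin (A :&: J)%VS by rewrite memv_cap (negPf wA).
have [H [AJH HJ dJ wH]] := ex_hyperplane (capvSr A J) wJ wAJ.
(* If [A] were inside [cl H], so would be [J], against the independence of [J]. The vector [a]
   replaces [w]; since [H] contains [A :&: J], nothing of that intersection is lost. *)
have /subvPn[a aA aH] : ~~ (A <= cl H)%VS.
  apply/negP => AH; apply: (iJ H) => //; apply: closure_eq => //.
  exact: subv_trans JclA (closure_le AH).
have aH' : a \notin H by apply: contra aH; apply: subvP (Cl1 hcl H) a.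
have sub : ((A :&: J) + <[a]> <= A :&: (H + <[a]>))%VS.
  by rewrite subv_cap addvS // subv_add capvSl -memvE aA.
have aAJ : a \notin (A :&: J)%VS by apply: contra aH'; apply: subvP AJH a.
have := dimvS sub; rewrite dim_addv_line // => lt_cap.
have le_cap := dimvS (capvSl A (H + <[a]>)).
rewrite dJ -(dim_addv_line aH'); apply: IHn; first lia.
  by apply: indep_adjoin => //; apply: indep_sub HJ.
by rewrite subv_add (subv_trans HJ) // -memvE (subvP (Cl1 hcl A)).
Qed.

Lemma indep_augment I J : indep I -> indep J -> \dim I < \dim J ->
  exists x : {vspace E},
    [/\ \dim x = 1%N, (x <= J)%VS, ~~ (x <= I)%VS & indep (I + x)%VS].
Proof.
move=> iI iJ ltIJ; have /subvPn[v vJ vI] : ~~ (J <= cl I)%VS.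
  by apply/negP => /(indep_dim_le iJ); rewrite leqNgt ltIJ.
exists <[v]>%VS; split; rewrite -?memvE //; last exact: indep_adjoin.
  by rewrite dim_vline; case: eqVneq vI => // ->; rewrite mem0v.
by apply: contra vI; apply: subvP (Cl1 hcl I) v.
Qed.

(** Starting from [0], adjoin vectors of [U] outside the current closure; the dimension of [U]
    bounds the number of steps. *)
Lemma ex_indep_spanning U :
  exists K, [/\ indep K, (K <= U)%VS & (U <= cl K)%VS].
Proof.
suff extend n K : \dim U - \dim K < n -> indep K -> (K <= U)%VS ->
    exists K, [/\ indep K, (K <= U)%VS & (U <= cl K)%VS].
  exact: extend _ 0%VS (ltnSn _) indep0 (sub0v U).
elim: n K => // n IHn K ltn iK KU.
have [UK|/subvPn[v vU vK]] := boolP (U <= cl K)%VS; first by exists K.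
have vK' : v \notin K by apply: contra vK; apply: subvP (Cl1 hcl K) v.
have KvU : (K + <[v]> <= U)%VS by rewrite subv_add KU -memvE.
apply: (IHn (K + <[v]>)%VS) => //; last exact: indep_adjoin.
have := dimvS KvU; rewrite dim_addv_line //; lia.
Qed.

Lemma max_indep_spanning A I : max_in indep A I -> (A <= cl I)%VS.
Proof.
case=> iI IA maxI; apply/idPn => /subvPn[v vA vI].
case/negP: (vI); apply: (subvP (Cl1 hcl I)).
have IvI : (I + <[v]>)%VS = I.
  apply: maxI; rewrite ?addvSl ?subv_add ?IA -?memvE //.
  exact: indep_adjoin.
by rewrite -IvI memvE addvSr.
Qed.

Lemma spanning_max_indep A K : indep K -> (K <= A)%VS -> (A <= cl K)%VS ->
  max_in indep A K.
Proof.
move=> iK KA AK; split=> // J iJ JA KJ; apply/eqP; rewrite eq_sym eqEdim KJ.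
exact: indep_dim_le (subv_trans JA AK).
Qed.

End IndependenceOfClosure.

Theorem theorem36 (F : fieldType) (E : vectType F)
    (cl : {vspace E} -> {vspace E}) (hcl : closure_axioms cl) :
  independence_axioms (indep_of_closure cl).
Proof.
split.
- by exists 0%VS; apply: indep0.
- by move=> I J; apply: indep_sub.
- by move=> I J; apply: indep_augment.
move=> A B I J maxI maxJ.
(* Choosing [K] inside [I + J] rather than [A + B] makes the inclusion required by (I4) immediate;
   [K] still spans [A + B], because [A] and [B] lie in [cl (I + J)]. *)
have [K [iK KIJ IJK]] := ex_indep_spanning hcl (I + J)%VS.
have AI := max_indep_spanning hcl maxI; have BJ := max_indep_spanning hcl maxJ.
case: maxI maxJ => [_ IA _] [_ JB _]; exists K => //.
apply: spanning_max_indep => //; first exact: subv_trans KIJ (addvS IA JB).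
apply: subv_trans (closure_le hcl IJK); rewrite subv_add.
by rewrite (subv_trans AI) ?(subv_trans BJ) ?(Cl2 hcl) ?addvSl ?addvSr.
Qed.
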